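(* Let $\ell\ge1$ and let $a,b\in\{0,\dots,2^\ell-1\}$ be $\ell$-bit unsigned integers with bits $a_i,b_i$ ($0\le i\le \ell-1$, $a=\sum_i2^ia_i$, $b=\sum_i 2^ib_i$). Let $a'=\sum_{i<\ell-1}2^ia_i$ and $b'=\sum_{i<\ell-1}2^ib_i$ be the integers formed by their lower $\ell-1$ bits, and let $A=(-1)^{a_{\ell-1}}$, $B=(-1)^{b_{\ell-1}}$. Then $$|a-b|=\frac{1+AB}{2}\,|a'-b'|+2^{\ell-2}(1-AB)+\frac{B-A}{2}\,(a'-b'),$$ where the distance between two zero-bit integers is $0$. Moreover, for every $\ell\ge1$, the Walsh expansion of the function $(a,b)\mapsto|a-b|$ on pairs of $\ell$-bit integers has exactly $$T_\ell=5\cdot2^\ell-4\ell-4$$ nonzero coefficients, counting the constant coefficient.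
   Context: The Walsh expansion of a function $g$ of two $\ell$-bit integers $(a,b)$ is its unique expansion $g(a,b)=\sum_{j=0}^{2^{2\ell}-1}c_j(-1)^{\mathrm{popcount}(z\,\&\,j)}$ with $z=a+2^\ell b$ and real coefficients $c_j$, where $\&$ is bitwise AND and popcount counts set bits; equivalently, the expansion as a multilinear polynomial in the signs $(-1)^{a_i},(-1)^{b_i}$. The constant coefficient is $c_0$. *)

(* Defs.v *)
From mathcomp Require Import all_boot all_order all_algebra.
From mathcomp Require Import reals.

Set Implicit Arguments.
Unset Strict Implicit.
Unset Printing Implicit Defensive.

Import Order.TTheory GRing.Theory Num.Theory.
Local Open Scope ring_scope.

Definition bit (n i : nat) : bool := Nat.testbit n i.

(* No bit is missed: n < 2 ^ n, so all set bits of n have index below n. *)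
Definition popcount (n : nat) : nat := (\sum_(i < n) bit n i)%N.

Definition low_bits (k n : nat) : nat := (\sum_(i < k) 2 ^ i * bit n i)%N.

Definition bit_sign (R : realType) (n i : nat) : R := (-1) ^+ bit n i.

Definition is_walsh_expansion (R : realType) (l : nat)
    (g : 'I_(2 ^ l)%N -> 'I_(2 ^ l)%N -> R)
    (c : {ffun 'I_(2 ^ (2 * l))%N -> R}) : Prop :=
  forall a b : 'I_(2 ^ l)%N,
    g a b = \sum_(j < (2 ^ (2 * l))%N)
              c j * (-1) ^+ popcount (Nat.land (a + 2 ^ l * b)%N j).

Definition absdiff (R : realType) (m n : nat) : R := `|m%:R - n%:R|.

(* Main.v *)
(** Splitting off the top bits of [a] and [b] is a four-way case analysis on
    (A, B).  It turns the identity for |a - b| into a recursion on the Walsh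
    coefficients, indexed by pairs (p, q) of masks: the four choices of the top
    bits of (p, q) are the coefficients of 1, A, B and AB.  Those of 1 and AB are
    half the coefficients of |a' - b'|, except that 2^(l-2) is added to,
    respectively subtracted from, the constant term; neither constant term
    vanishes because the mean of |a' - b'| lies in [0, 2^(l-1)).  Those of A and
    B are halves of the 2(l-1) coefficients of a' - b'.  Hence the number N of
    nonconstant terms satisfies N(l) = 2 N(l-1) + 1 + 4(l-1) with N(0) = 0. *)
From Stdlib Require PeanoNat.
Require Import Defs.
From mathcomp Require Import all_boot all_order all_algebra.
From mathcomp Require Import reals.
From mathcomp Require Import zify ring lra.

Import Order.TTheory GRing.Theory Num.Theory.
Local Open Scope ring_scope.

(** * Bits of concatenated integers *)

Lemma bitE (n i : nat) : bit n i = odd (n %/ 2 ^ i)%N.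
Proof.
have odd_nat k : Nat.odd k = odd k.
  by elim: k => // k IHk; rewrite PeanoNat.Nat.odd_succ -PeanoNat.Nat.negb_odd IHk.
have div2_nat k : Nat.div2 k = (k %/ 2)%N.
  (* [Nat.div2] recurses two steps at a time, so the induction carries two consecutive values. *)
  rewrite divn2; suff [-> //] : Nat.div2 k = k./2 /\ Nat.div2 k.+1 = k.+1./2.
  by elim: k => // k [IHk IHk1]; split=> //=; rewrite IHk.
rewrite /bit; elim: i n => [|i IHi] n /=; first by rewrite divn1.
by rewrite IHi div2_nat expnS divnMA.
Qed.

Lemma bit_cat_low (k a b i : nat) : (i < k)%N -> bit (a + 2 ^ k * b) i = bit a i.
Proof.
move=> ltik; rewrite !bitE.
(* The isolated factor 2 makes the contribution of [b] to the quotient by [2 ^ i] even. *)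
have -> : (a + 2 ^ k * b = 2 ^ (k - i.+1) * b * 2 * 2 ^ i + a)%N.
  by rewrite -[in LHS](subnK ltik) expnD expnS; ring.
by rewrite divnMDl ?expn_gt0 // oddD oddM andbF.
Qed.

Lemma bit_cat_high (k a b i : nat) :
  (a < 2 ^ k)%N -> bit (a + 2 ^ k * b) (k + i) = bit b i.
Proof.
move=> lta; rewrite !bitE expnD divnMA addnC mulnC divnMDl ?expn_gt0 //.
by rewrite (divn_small lta) addn0.
Qed.

Lemma bit_small (n i : nat) : (n < 2 ^ i)%N -> bit n i = false.
Proof. by move=> ltn; rewrite bitE divn_small. Qed.

Lemma popcount_land (k n m : nat) :
  (m < 2 ^ k)%N -> popcount (Nat.land n m) = (\sum_(i < k) (bit n i && bit m i))%N.
Proof.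
move=> ltm; rewrite /popcount.
have landE i : bit (Nat.land n m) i = bit n i && bit m i.
  exact: PeanoNat.Nat.land_spec.
(* The sum defining [popcount] runs up to the number itself, so both ranges are padded with zero
   terms to a common length. *)
pose N := (k + Nat.land n m)%N.
have widen j : (j <= N)%N -> (forall i, (j <= i)%N -> ~~ (bit n i && bit m i)) ->
    (\sum_(i < j) (bit n i && bit m i) = \sum_(i < N) (bit n i && bit m i))%N.
  move=> leN zero; rewrite (big_ord_widen _ (fun i => nat_of_bool (bit n i && bit m i)) leN).
  rewrite big_mkcond; apply: eq_bigr => i _; case: ltnP => // /zero.
  by case: (_ && _).
under eq_bigr do rewrite landE.
rewrite (widen (Nat.land n m)) ?leq_addl // ?(widen k) ?leq_addr // => i lei.
  by rewrite (@bit_small m) ?andbF // (leq_trans ltm) ?leq_exp2l.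
rewrite -landE bit_small // (leq_trans _ (leq_trans (ltn_expl i (isT : 1 < 2)%N) _)) //.
Qed.

Lemma popcount_land_cat (k a b p q : nat) : (a < 2 ^ k)%N -> (p < 2 ^ k)%N ->
  popcount (Nat.land (a + 2 ^ k * b) (p + 2 ^ k * q)) =
  (popcount (Nat.land a p) + popcount (Nat.land b q))%N.
Proof.
(* No bit length is given for [q]; [q] itself serves as one. *)
move=> lta ltp; have ltq : (q < 2 ^ q)%N by rewrite ltn_expl.
have lt_cat : (p + 2 ^ k * q < 2 ^ (k + q))%N.
  rewrite expnD (@leq_trans (2 ^ k * q.+1)) ?leq_pmul2l ?expn_gt0 //.
  by rewrite mulnS ltn_add2r.
rewrite (popcount_land _ _ _ lt_cat) (popcount_land _ _ _ ltp).
rewrite (popcount_land _ _ _ ltq) big_split_ord /=; congr (_ + _)%N.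
  by apply: eq_bigr => i _; rewrite !bit_cat_low.
by apply: eq_bigr => i _; rewrite !bit_cat_high.
Qed.

Lemma low_bits_mod (k n : nat) : low_bits k n = (n %% 2 ^ k)%N.
Proof.
rewrite /low_bits; elim: k => [|k IHk]; first by rewrite big_ord0 modn1.
rewrite big_ord_recr /= IHk bitE.
(* Bit [k] is the quotient of [n %% 2 ^ k.+1] by [2 ^ k], so the recursion is Euclidean division of
   that remainder. *)
rewrite -modn2 modn_divl -expnS [RHS](divn_eq _ (2 ^ k)) modn_dvdm ?dvdn_exp2l //.
by rewrite addnC mulnC.
Qed.

(** * Walsh functions and sums over dyadic ranges *)

Definition walsh (R : realType) (a p : nat) : R := (-1) ^+ popcount (Nat.land a p).

Lemma walsh_cat (R : realType) (k a b p q : nat) :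
  (a < 2 ^ k)%N -> (p < 2 ^ k)%N ->
  walsh R (a + 2 ^ k * b) (p + 2 ^ k * q) = walsh R a p * walsh R b q.
Proof. by move=> lta ltp; rewrite /walsh popcount_land_cat // exprD. Qed.

Lemma walsh_bool (R : realType) (x y : bool) : walsh R x y = (-1) ^+ (x && y).
Proof. by rewrite /walsh /popcount; case: x y => [] []; rewrite ?big_ord1 ?big_ord0. Qed.

Lemma walsh0 (R : realType) (a : nat) : walsh R a 0 = 1.
Proof. by rewrite /walsh (popcount_land 0) // big_ord0. Qed.

(** The factor [true] keeps the top bit visible as a boolean, the shape that [walsh_cat] and
    [quad_cat] match. *)
Lemma sum_pow2S (V : nmodType) (k : nat) (F : nat -> V) :
  \sum_(p < 2 ^ k.+1) F p =
  \sum_(p < 2 ^ k) F p + \sum_(p < 2 ^ k) F (p + 2 ^ k * true)%N.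
Proof.
have -> : (2 ^ k.+1 = 2 ^ k + 2 ^ k)%N by rewrite expnS mul2n addnn.
rewrite big_split_ord /=; congr (_ + _).
by apply: eq_bigr => p _; rewrite muln1 addnC.
Qed.

Lemma sum_sum_pow2S (V : nmodType) (k : nat) (F : nat -> nat -> V) :
  \sum_(p < 2 ^ k.+1) \sum_(q < 2 ^ k.+1) F p q =
  \sum_(P : bool) \sum_(Q : bool) \sum_(p < 2 ^ k) \sum_(q < 2 ^ k)
    F (p + 2 ^ k * P)%N (q + 2 ^ k * Q)%N.
Proof.
rewrite (sum_pow2S _ _ (fun p => \sum_(q < 2 ^ k.+1) F p q)) !big_bool /= [RHS]addrC.
congr (_ + _); rewrite [RHS]addrC -big_split; apply: eq_bigr => p _ /=.
  rewrite muln0 addn0 (sum_pow2S _ _ (F p)); congr (_ + _).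
  by apply: eq_bigr => q _; rewrite addn0.
rewrite (sum_pow2S _ _ (F _)); congr (_ + _).
by apply: eq_bigr => q _; rewrite muln0 addn0.
Qed.

Lemma sum_pow2D (V : nmodType) (k m : nat) (F : nat -> V) :
  \sum_(j < 2 ^ (k + m)) F j = \sum_(p < 2 ^ k) \sum_(q < 2 ^ m) F (p + 2 ^ k * q)%N.
Proof.
rewrite exchange_big /= expnD mulnC.
(* The induction is on the number of blocks of length [2 ^ k]. *)
elim: (2 ^ m)%N => [|n IHn]; first by rewrite mul0n !big_ord0.
rewrite mulSnr big_split_ord big_ord_recr /= IHn; congr (_ + _).
by apply: eq_bigr => p _; rewrite addnC mulnC.
Qed.

Lemma sum_sum_origin (V : nmodType) (k : nat) (F : nat -> nat -> V) :
  \sum_(p < 2 ^ k) \sum_(q < 2 ^ k) (if (p == 0 :> nat) && (q == 0 :> nat) then F p q else 0)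
  = F 0 0.
Proof.
have gt0 : (0 < 2 ^ k)%N by rewrite expn_gt0.
rewrite (bigD1 (Ordinal gt0)) //= (bigD1 (Ordinal gt0)) //= !big1 ?addr0 //.
  by move=> p; rewrite -val_eqE /= => /negPf nz; rewrite big1 // => q _; rewrite nz.
by move=> q; rewrite -val_eqE /= => /negPf ->.
Qed.

(* Evaluating at [z] and at [z + 2 ^ n] separates the sum and the difference of
   the two halves of [f], both of which vanish by induction. *)
Lemma walsh_free (R : realType) (n : nat) (f : nat -> R) :
  (forall z, (z < 2 ^ n)%N -> \sum_(j < 2 ^ n) f j * walsh R z j = 0) ->
  forall j, (j < 2 ^ n)%N -> f j = 0.
Proof.
elim: n f => [|n IHn] f sum0 j ltj.
  have := sum0 0%N isT; rewrite big_ord1 walsh0 mulr1.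
  by case: j ltj.
have low_high z : (z < 2 ^ n)%N -> forall x : bool,
    \sum_(j < 2 ^ n) (f j + (-1) ^+ x * f (j + 2 ^ n * true)%N) * walsh R z j = 0.
  move=> ltz x; rewrite -[RHS](sum0 (z + 2 ^ n * x)%N); last first.
    by case: x; rewrite expnS; lia.
  rewrite (sum_pow2S _ _ (fun j => f j * walsh R (z + 2 ^ n * x) j)) -big_split; apply: eq_bigr => i _ /=.
  have -> : walsh R (z + 2 ^ n * x) i = walsh R z i.
    have := walsh_cat R n z x i false ltz (ltn_ord i).
    by rewrite walsh_bool andbF muln0 addn0 mulr1.
  rewrite walsh_cat // (walsh_bool R x true) andbT.
  by ring.
have sum_eq0 x i : (i < 2 ^ n)%N -> f i + (-1) ^+ (x : bool) * f (i + 2 ^ n * true)%N = 0.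
  by apply: (IHn (fun i => f i + _ * f (i + _)%N)) => z ltz; apply: low_high.
have both0 i : (i < 2 ^ n)%N -> f i = 0 /\ f (i + 2 ^ n * true)%N = 0.
  move=> lti; have := sum_eq0 false i lti; have := sum_eq0 true i lti.
  by rewrite expr1 expr0; lra.
have [ltjn|lejn] := ltnP j (2 ^ n); first by have [] := both0 _ ltjn.
have [|_] := both0 (j - 2 ^ n)%N; first by move: ltj; rewrite expnS; lia.
by rewrite muln1 subnK.
Qed.

(* [f P Q] is used on the quadrant where [p] and [q] have [k]-th bits [P] and [Q]. *)
Definition quad {T : Type} (k : nat) (f : bool -> bool -> nat -> nat -> T) (p q : nat) : T :=
  f (2 ^ k <= p)%N (2 ^ k <= q)%N (p %% 2 ^ k)%N (q %% 2 ^ k)%N.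

Lemma quad_cat (T : Type) (k : nat) (f : bool -> bool -> nat -> nat -> T)
    (p q : nat) (P Q : bool) :
  (p < 2 ^ k)%N -> (q < 2 ^ k)%N ->
  quad k f (p + 2 ^ k * P) (q + 2 ^ k * Q) = f P Q p q.
Proof.
have topE r (x : bool) : (r < 2 ^ k)%N ->
    ((2 ^ k <= r + 2 ^ k * x)%N = x) * ((r + 2 ^ k * x) %% 2 ^ k = r)%N.
  move=> ltr; rewrite mulnC addnC modnMDl modn_small //; split=> //.
  by case: x; rewrite ?mul1n ?leq_addr // mul0n leqNgt ltr.
by move=> ltp ltq; rewrite /quad !topE.
Qed.

(** * Walsh sums in two variables *)

Definition walsh_sum (R : realType) (k : nat) (f : nat -> nat -> R) (a b : nat) : R :=
  \sum_(p < 2 ^ k) \sum_(q < 2 ^ k) f p q * (walsh R a p * walsh R b q).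

Definition origin (R : realType) (p q : nat) : R := ((p == 0%N) && (q == 0%N))%:R.

Lemma walsh_sum_quad (R : realType) (k : nat) f (a b : nat) (x y : bool) :
  (a < 2 ^ k)%N -> (b < 2 ^ k)%N ->
  walsh_sum R k.+1 (quad k f) (a + 2 ^ k * x) (b + 2 ^ k * y) =
  \sum_(P : bool) \sum_(Q : bool)
    (-1) ^+ (x && P) * (-1) ^+ (y && Q) * walsh_sum R k (f P Q) a b.
Proof.
move=> lta ltb; rewrite /walsh_sum.
rewrite (sum_sum_pow2S _ _ (fun p q => quad k f p q * (walsh R _ p * walsh R _ q))).
apply: eq_bigr => P _; apply: eq_bigr => Q _; rewrite mulr_sumr.
apply: eq_bigr => p _; rewrite mulr_sumr; apply: eq_bigr => q _.
by rewrite quad_cat // !walsh_cat // !walsh_bool; ring.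
Qed.

(** The Walsh function of the zero mask is constantly 1, so [origin] contributes a constant. *)
Lemma walsh_sum_affine (R : realType) (k : nat) (x y : R) f (a b : nat) :
  walsh_sum R k (fun p q => x * f p q + y * origin R p q) a b =
  x * walsh_sum R k f a b + y.
Proof.
transitivity (x * walsh_sum R k f a b + \sum_(p < 2 ^ k) \sum_(q < 2 ^ k)
    (if (p == 0 :> nat) && (q == 0 :> nat) then y * (walsh R a p * walsh R b q) else 0)).
  rewrite /walsh_sum mulr_sumr -big_split; apply: eq_bigr => p _ /=.
  rewrite mulr_sumr -big_split; apply: eq_bigr => q _ /=.
  by rewrite /origin; case: ifP => _ /=; ring.
rewrite (sum_sum_origin _ _ (fun p q => y * (walsh R a p * walsh R b q))).
by rewrite !walsh0 !mulr1.
Qed.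

(** * Recursive coefficients of the difference and the distance *)

(** Equal top bits cancel. If they differ, the summand [2 ^ k] outweighs the lower parts and fixes
    the sign of the difference. *)
Lemma absdiff_top_bit (R : realType) (k a b : nat) (x y : bool) :
  (a < 2 ^ k)%N -> (b < 2 ^ k)%N ->
  let A := (-1) ^+ x in
  let B := (-1) ^+ y in
  absdiff R (a + 2 ^ k * x) (b + 2 ^ k * y) =
  (1 + A * B) / 2 * absdiff R a b + 2 ^+ k / 2 * (1 - A * B)
  + (B - A) / 2 * (a%:R - b%:R).
Proof.
move=> lta ltb; rewrite /absdiff !natrD !natrM natrX.
have {}lta : a%:R <= 2 ^+ k :> R by rewrite -natrX ler_nat ltnW.
have {}ltb : b%:R <= 2 ^+ k :> R by rewrite -natrX ler_nat ltnW.
have ge0a : 0 <= a%:R :> R by rewrite ler0n.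
have ge0b : 0 <= b%:R :> R by rewrite ler0n.
case: x y => [] [] /=; rewrite ?expr1 ?expr0 ?mulr1 ?mulr0 ?addr0.
- by rewrite opprD addrACA subrr addr0; lra.
- by rewrite ger0_norm; lra.
- by rewrite ler0_norm; lra.
- by lra.
Qed.

(** Since a top bit equals (1 - A)/2, the recursion is a - b = (a' - b') + (2^k/2)(B - A), which has
    no AB term. *)
Fixpoint diff_coef (R : realType) (k : nat) : nat -> nat -> R :=
  if k is k'.+1 then
    quad k' (fun P Q p q =>
      if P == Q then (if P then 0 else diff_coef R k' p q)
      else (-1) ^+ P * (2 ^+ k' / 2) * origin R p q)
  else fun _ _ => 0.

(** Quadrant (P, Q) holds the factor of A^P B^Q in [absdiff_top_bit]. *)
Fixpoint absdiff_coef (R : realType) (k : nat) : nat -> nat -> R :=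
  if k is k'.+1 then
    quad k' (fun P Q p q =>
      if P == Q then 2^-1 * absdiff_coef R k' p q
                     + (-1) ^+ P * (2 ^+ k' / 2) * origin R p q
      else (-1) ^+ P / 2 * diff_coef R k' p q)
  else fun _ _ => 0.

Lemma absdiff_coefS (R : realType) (k : nat) :
  absdiff_coef R k.+1 = quad k (fun P Q p q =>
    if P == Q then 2^-1 * absdiff_coef R k p q + (-1) ^+ P * (2 ^+ k / 2) * origin R p q
    else (-1) ^+ P / 2 * diff_coef R k p q).
Proof. by []. Qed.

Lemma walsh_sumZ (R : realType) (k : nat) (x : R) f (a b : nat) :
  walsh_sum R k (fun p q => x * f p q) a b = x * walsh_sum R k f a b.
Proof.
rewrite /walsh_sum mulr_sumr; apply: eq_bigr => p _; rewrite mulr_sumr.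
by apply: eq_bigr => q _; rewrite -mulrA.
Qed.

Lemma walsh_sum0 (R : realType) (k : nat) (a b : nat) :
  walsh_sum R k (fun _ _ => 0) a b = 0.
Proof. by rewrite /walsh_sum big1 // => p _; rewrite big1 // => q _; rewrite mul0r. Qed.

Lemma walsh_sum_origin (R : realType) (k : nat) (x : R) (a b : nat) :
  walsh_sum R k (fun p q => x * origin R p q) a b = x.
Proof.
rewrite -[RHS](addr0 x) -[in RHS](mul0r (walsh_sum R k (fun _ _ => 0) a b)) addrC.
rewrite -walsh_sum_affine; apply: eq_bigr => p _; apply: eq_bigr => q _.
by rewrite mul0r add0r.
Qed.

Lemma split_top_bit (k a : nat) : (a < 2 ^ k.+1)%N ->
  exists a' (x : bool), (a' < 2 ^ k)%N /\ a = (a' + 2 ^ k * x)%N.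
Proof.
move=> lta; have [lt|le] := ltnP a (2 ^ k).
  by exists a, false; rewrite muln0 addn0.
by exists (a - 2 ^ k)%N, true; rewrite muln1 subnK //; split=> //; move: lta; rewrite expnS; lia.
Qed.

Lemma diff_coefP (R : realType) (k a b : nat) : (a < 2 ^ k)%N -> (b < 2 ^ k)%N ->
  walsh_sum R k (diff_coef R k) a b = a%:R - b%:R.
Proof.
elim: k a b => [|k IHk] a b.
  by case: a b => [|//] [|//] _ _; rewrite subrr walsh_sum0.
case/split_top_bit => a' [x [lta ->]] /split_top_bit[b' [y [ltb ->]]].
rewrite walsh_sum_quad // !big_bool /= !walsh_sum_origin walsh_sum0 IHk //.
rewrite !natrD !natrM natrX.
by case: x y {ltb lta} => [] [] /=; rewrite ?expr1 ?expr0; lra.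
Qed.

Lemma absdiff_coefP (R : realType) (k a b : nat) : (a < 2 ^ k)%N -> (b < 2 ^ k)%N ->
  walsh_sum R k (absdiff_coef R k) a b = absdiff R a b.
Proof.
elim: k a b => [|k IHk] a b.
  by case: a b => [|//] [|//] _ _; rewrite /absdiff subrr normr0 walsh_sum0.
case/split_top_bit => a' [x [lta ->]] /split_top_bit[b' [y [ltb ->]]].
rewrite walsh_sum_quad // !big_bool /= !walsh_sum_affine !walsh_sumZ IHk //.
rewrite diff_coefP // absdiff_top_bit //.
by case: x y => [] [] /=; rewrite ?expr1 ?expr0; lra.
Qed.

(** The constant coefficient c becomes c/2 + 2^k/2, which preserves the bounds. The strict upper one
    makes c/2 - 2^k/2, the entry of the AB quadrant, negative. *)
Lemma absdiff_coef0_bounds (R : realType) (k : nat) :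
  0 <= absdiff_coef R k 0 0 < 2 ^+ k.
Proof.
elim: k => [|k /andP[ge0 lt]]; first by rewrite lexx /= expr0 ltr01.
have pow_gt0 : 0 < 2 ^+ k :> R by rewrite exprn_gt0.
rewrite /= /quad mod0n !leqn0 expn_eq0 /= /origin /= expr0 exprS; lra.
Qed.

(** * Counting nonzero coefficients *)

Definition support_size (R : realType) (k : nat) (f : nat -> nat -> R) : nat :=
  (\sum_(p < 2 ^ k) \sum_(q < 2 ^ k) (f p q != 0%R))%N.

Lemma support_size_quad (R : realType) (k : nat) (f : bool -> bool -> nat -> nat -> R) :
  support_size R k.+1 (quad k f) =
  (\sum_(P : bool) \sum_(Q : bool) support_size R k (f P Q))%N.
Proof.
rewrite /support_size (sum_sum_pow2S _ _ (fun p q => nat_of_bool (quad k f p q != 0))).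
do 2![apply: eq_bigr => ? _]; do 2![apply: eq_bigr => ? _].
by rewrite quad_cat.
Qed.

(** Only the entry at the origin can change status, and it ends up nonzero. The additive form avoids
    truncated subtraction. *)
Lemma support_size_affine (R : realType) (k : nat) (x y : R) (f : nat -> nat -> R) :
  x != 0 -> x * f 0 0 + y != 0 ->
  (support_size R k (fun p q => x * f p q + y * origin R p q)%R + (f 0 0 != 0%R)
   = support_size R k f + 1)%N.
Proof.
move=> nzx nz0; rewrite /support_size.
rewrite -(sum_sum_origin _ k (fun p q => nat_of_bool (f p q != 0))).
rewrite -[X in _ = (_ + X)%N](sum_sum_origin _ k (fun _ _ => 1%N)).
rewrite -!big_split; apply: eq_bigr => p _ /=.
rewrite -!big_split; apply: eq_bigr => q _ /=.
rewrite /origin; case: ifP => [/andP[/eqP-> /eqP->]|_] /=.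
  by rewrite mulr1 nz0 addnC.
by rewrite mulr0 addr0 mulf_eq0 negb_or nzx.
Qed.

Lemma support_sizeZ (R : realType) (k : nat) (x : R) (f : nat -> nat -> R) :
  x != 0 -> support_size R k (fun p q => x * f p q) = support_size R k f.
Proof.
move=> nzx; apply: eq_bigr => p _; apply: eq_bigr => q _.
by rewrite mulf_eq0 negb_or nzx.
Qed.

Lemma support_size0 (R : realType) (k : nat) :
  support_size R k (fun _ _ => 0) = 0%N.
Proof. by rewrite /support_size big1 // => p _; rewrite big1 // => q _; rewrite eqxx. Qed.

Lemma support_size_origin (R : realType) (k : nat) (x : R) :
  x != 0 -> support_size R k (fun p q => x * origin R p q) = 1%N.
Proof.
move=> nzx; rewrite support_sizeZ // -[RHS](sum_sum_origin _ k (fun _ _ => 1%N)).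
apply: eq_bigr => p _; apply: eq_bigr => q _; rewrite /origin.
by case: ifP; rewrite ?oner_eq0 ?eqxx.
Qed.

(** Each new bit adds one coefficient for A and one for B. *)
Lemma support_size_diff (R : realType) (k : nat) :
  support_size R k (diff_coef R k) = (2 * k)%N.
Proof.
elim: k => [|k IHk]; first exact: support_size0.
have nz2k : 2 ^+ k / 2 != 0 :> R by rewrite mulf_neq0 ?expf_neq0 ?invr_eq0 ?pnatr_eq0.
rewrite support_size_quad !big_bool /= support_size0 IHk.
by rewrite !support_size_origin ?(mulf_neq0 _ nz2k) ?signr_eq0 //; lia.
Qed.

(* The last term corrects for [k = 0], where the constant coefficient is zero. *)
Lemma support_size_absdiff (R : realType) (k : nat) :
  (support_size R k (absdiff_coef R k) + 4 * k + 5 = 5 * 2 ^ k + (0 < k))%N.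
Proof.
elim: k => [|k IHk]; first by rewrite support_size0.
have nz2 : 2^-1 != 0 :> R by rewrite invr_eq0 pnatr_eq0.
have pow_gt0 : 0 < 2 ^+ k :> R by rewrite exprn_gt0.
have /andP[ge0 ltk] := absdiff_coef0_bounds R k.
have low_neq0 (P : bool) :
    2^-1 * absdiff_coef R k 0 0 + (-1) ^+ P * (2 ^+ k / 2) != 0.
  by case: P; rewrite ?expr1 ?expr0; [apply: ltr0_neq0|apply: lt0r_neq0]; lra.
(* At positive level the recursion adds a positive power of 2 to a nonnegative half. *)
have coef0_neq0 : (absdiff_coef R k 0 0 != 0) = (0 < k)%N.
  case: k {IHk nz2 pow_gt0 ge0 ltk low_neq0} => [|k]; first by rewrite eqxx.
  have /andP[ge0 _] := absdiff_coef0_bounds R k.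
  have pow_gt0 : 0 < 2 ^+ k :> R by rewrite exprn_gt0.
  apply: lt0r_neq0; rewrite /= /quad mod0n !leqn0 expn_eq0 /= /origin /= expr0; lra.
have high := support_size_affine R k _ _ _ nz2 (low_neq0 true).
have low := support_size_affine R k _ _ _ nz2 (low_neq0 false).
move: high low; rewrite absdiff_coefS support_size_quad !big_bool /= !support_sizeZ ?mulf_neq0 ?signr_eq0 //.
rewrite support_size_diff coef0_neq0 expnS; move: IHk.
(* Here [s] is the count at level [k], while [s1] and [s0] count the AB and constant quadrants; each
   of the other two contributes [2 * k]. *)
set s := support_size R k _; set s1 := support_size R k _; set s0 := support_size R k _.
by move: s s0 s1 (2 ^ k)%N => s s0 s1 m; lia.
Qed.

Theorem lemma1 (R : realType) (l : nat) (hl : (1 <= l)%N) :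
  (forall a b : 'I_(2 ^ l)%N,
     let a' := low_bits l.-1 a in
     let b' := low_bits l.-1 b in
     let A := bit_sign R a l.-1 in
     let B := bit_sign R b l.-1 in
     absdiff R a b
     = (1 + A * B) / 2 * absdiff R a' b'
       + 2 ^ (l%:Z - 2) * (1 - A * B)
       + (B - A) / 2 * (a'%:R - b'%:R))
  /\
  (exists c : {ffun 'I_(2 ^ (2 * l))%N -> R},
     unique (is_walsh_expansion (fun a b : 'I_(2 ^ l)%N => absdiff R a b)) c
     /\ #|[set j | c j != 0]|%:Z = 5 * 2 ^+ l - 4 * l%:Z - 4).
Proof.
split.
  case: l hl => // k _ a b.
  have [a' [x [lta ea]]] := split_top_bit _ _ (ltn_ord a).
  have [b' [y [ltb eb]]] := split_top_bit _ _ (ltn_ord b).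
  have low n (z : bool) : (n < 2 ^ k)%N -> low_bits k (n + 2 ^ k * z) = n.
    by move=> ltn; rewrite low_bits_mod addnC mulnC modnMDl modn_small.
  have top n (z : bool) : (n < 2 ^ k)%N -> bit_sign R (n + 2 ^ k * z) k = (-1) ^+ z.
    move=> ltn; rewrite /bit_sign -[X in bit _ X]addn0 bit_cat_high // bitE divn1.
    by rewrite oddb.
  (* The exponent is an integer and equals -1 when [l] is 1. *)
  have -> : 2 ^ (k.+1%:Z - 2) = 2 ^+ k / 2 :> R.
    have -> : k.+1%:Z - 2 = k%:Z - 1 by lia.
    by rewrite expfzDr ?pnatr_eq0.
  by rewrite /= ea eb !low // !top // absdiff_top_bit.
have sum_split (V : nmodType) (F : nat -> V) : \sum_(j < 2 ^ (2 * l)) F j =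
    \sum_(p < 2 ^ l) \sum_(q < 2 ^ l) F (p + 2 ^ l * q)%N.
  by rewrite mul2n -addnn sum_pow2D.
have dim_gt0 : (0 < 2 ^ l)%N by rewrite expn_gt0.
have decode j : (j < 2 ^ (2 * l))%N ->
    exists a b, [/\ (a < 2 ^ l)%N, (b < 2 ^ l)%N & j = (a + 2 ^ l * b)%N].
  move=> ltj; exists (j %% 2 ^ l)%N, (j %/ 2 ^ l)%N.
  by rewrite ltn_mod ltn_divLR // -expnD addnn -mul2n; split=> //; rewrite addnC mulnC -divn_eq.
(* A single index [j] packs the pair of masks just as z = a + 2^l b packs the arguments. *)
pose coef (j : nat) := absdiff_coef R l (j %% 2 ^ l) (j %/ 2 ^ l).
have coef_cat p q : (p < 2 ^ l)%N -> coef (p + 2 ^ l * q)%N = absdiff_coef R l p q.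
  move=> ltp; rewrite /coef addnC mulnC modnMDl divnMDl // modn_small //.
  by rewrite divn_small // addn0.
have coefP (a b : 'I_(2 ^ l)) :
    absdiff R a b = \sum_(j < 2 ^ (2 * l)) coef j * walsh R (a + 2 ^ l * b) j.
  rewrite -(absdiff_coefP R l) // (sum_split _ (fun j => coef j * walsh R (a + 2 ^ l * b) j)).
  by do 2![apply: eq_bigr => ? _]; rewrite coef_cat // walsh_cat.
exists [ffun j : 'I_(2 ^ (2 * l)) => coef j]; split.
  split=> [a b|c cP]; first by rewrite coefP; apply: eq_bigr => j _; rewrite ffunE.
  (* [walsh_free] concerns functions on all of [nat], so [c] is extended by 0. *)
  pose c' (j : nat) := if insub j is Some i then c i else 0.
  have c'E (i : 'I_(2 ^ (2 * l))) : c' i = c i by rewrite /c' valK.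
  apply/ffunP => j; rewrite ffunE -c'E; apply/eqP; rewrite -subr_eq0; apply/eqP.
  apply: (walsh_free R (2 * l)%N (fun j => coef j - c' j)) (ltn_ord j).
  (* Every evaluation point encodes a pair (a, b), at which both expansions equal |a - b|. *)
  move=> _ /decode[a [b [lta ltb ->]]].
  under eq_bigr do rewrite c'E mulrBl.
  rewrite sumrB -(coefP (Ordinal lta) (Ordinal ltb)) (cP (Ordinal lta) (Ordinal ltb)).
  by rewrite subrr.
have -> : #|[set j | [ffun j : 'I_(2 ^ (2 * l)) => coef j] j != 0]| =
    support_size R l (absdiff_coef R l).
  rewrite -sum1dep_card big_mkcond /=.
  (* The cardinal becomes a sum in the additive monoid [nat], to which [sum_split] applies. *)
  transitivity (\sum_(j < 2 ^ (2 * l)) nat_of_bool (coef j != 0))%R.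
    by apply: eq_bigr => j _; rewrite ffunE; case: eqP.
  rewrite (sum_split _ (fun j => nat_of_bool (coef j != 0))).
  by do 2![apply: eq_bigr => ? _]; rewrite coef_cat.
have -> : 2 ^+ l = (2 ^ l)%N%:Z by rewrite -natz natrX.
(* As [l] is positive, the correction term is 1 and turns the 5 into 4. *)
by have := support_size_absdiff R l; rewrite hl; lia.
Qed.
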